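(* Let $\mathcal{L}$ be a task list in dimension $n=n_{\mathrm{free}}$ with target $y^{*}\in\mathbb{R}^{J}$, and let $\|\cdot\|$ be the Euclidean norm on $\mathbb{R}^{J}$. For every network whose $K_{ff}$ is symmetric and invertible (passive networks included), whatever its size and topology, and for every admissible stiffness vector $k$, with $C=K_{ff}^{-1}$, $$\|y(C)-y^{*}\|\;\ge\;\operatorname{dist}(y^{*},\mathcal{S}_{\mathcal{L}})\;=\;\|\Pi_{\mathcal{A}_{\mathcal{L}}}y^{*}\|,$$ and the right-hand side splits orthogonally, $$\|\Pi_{\mathcal{A}_{\mathcal{L}}}y^{*}\|^2=\|\Pi_{\mathcal{A}^{0}_{\mathcal{L}}}y^{*}\|^2+\|\Pi_{\mathcal{A}^{1}_{\mathcal{L}}}y^{*}\|^2,\qquad \dim\mathcal{A}^{1}_{\mathcal{L}}=\delta_{\mathcal{L}}.$$ The quantity $\|\Pi_{\mathcal{A}^{0}_{\mathcal{L}}}y^{*}\|$ is the error that no linear response of any kind can remove, i.e. the distance from $y^{*}$ to $\{y(X):X\in\mathbb{R}^{n\times n}\}$, and the second term is the additional error imposed by symmetry. The floor $\|\Pi_{\mathcal{A}_{\mathcal{L}}}y^{*}\|$ vanishes if and only if $\sum_j\lambda_jy_j^{*}=0$ for every $\lambda\in\mathbb{R}^{J}$ with $\operatorname{sym}\mathsf{M}(\lambda)=0$. Over all symmetric $C\in\mathbb{R}^{n\times n}$ the bound is attained; over symmetric invertible $C$ it is the infimum, and it is attained for every $y^{*}$ outside a closed set with empty interior; over the admissible stiffnesses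 of a fixed graph it is a lower bound and is in general strict (there are networks, task lists and targets for which the inequality is strict at every admissible $k$).
   Context: Task list: a finite family $\mathcal{L}=\{(f_j,g_j,y^{*}_j)\}_{j=1}^{J}$ with $f_j,g_j\in\mathbb{R}^{n}$, $y_j^{*}\in\mathbb{R}$; $y^{*}=(y_j^{*})_j$. Put $\mathsf{M}_j=g_jf_j^{T}$ and, for $X\in\mathbb{R}^{n\times n}$, $y(X)\in\mathbb{R}^{J}$ with $y_j(X)=g_j^{T}Xf_j$. With $\operatorname{sym}A=\tfrac12(A+A^{T})$: $\mathcal{M}=\operatorname{span}\{\mathsf{M}_j\}$, $\mathcal{M}^{s}=\operatorname{span}\{\operatorname{sym}\mathsf{M}_j\}$, $\delta_{\mathcal{L}}=\dim\mathcal{M}-\dim\mathcal{M}^{s}$. For $\lambda\in\mathbb{R}^{J}$, $\mathsf{M}(\lambda)=\sum_j\lambda_j\mathsf{M}_j$. $\mathcal{A}^{0}_{\mathcal{L}}=\{\lambda:\mathsf{M}(\lambda)=0\}$, $\mathcal{A}_{\mathcal{L}}=\{\lambda:\operatorname{sym}\mathsf{M}(\lambda)=0\}$, $\mathcal{A}^{1}_{\mathcal{L}}=\mathcal{A}_{\mathcal{L}}\cap(\mathcal{A}^{0}_{\mathcal{L}})^{\perp}$, $\mathcal{S}_{\mathcal{L}}=\mathcal{A}_{\mathcal{L}}^{\perp}\subseteq\mathbb{R}^{J}$. $\Pi_E$ is the orthogonal projection of $\mathbb{R}^{J}$ onto a subspace $E$. Network: $N$ point nodes at positions $x_i\in\mathbb{R}^2$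 are joined by $n_b$ bonds. For a bond $b=(i,j)$ of length $L_b=|x_j-x_i|>0$ let $\hat n_b=(x_j-x_i)/L_b$ and let $\hat t_b$ be $\hat n_b$ rotated by $+90^\circ$. The vector $q_b\in\mathbb{R}^{2N}$ carries $-\hat n_b$ at node $i$, $+\hat n_b$ at node $j$, zeros elsewhere; $s_b$ is the same with $\hat t_b$. For stiffnesses $k=(k_b)$ and odd couplings $a=(a_b)$, $K=\sum_b(k_bq_b+a_bs_b)q_b^{T}$. Three degrees of freedom are pinned to remove the planar rigid-body modes and $K_{ff}$ is the restriction of $K$ to the remaining $n_{\mathrm{free}}=2N-3$ free ones. $k$ is admissible if all $k_b>0$ and $K_{ff}$ is invertible. Passive means $a\equiv0$ and $K_{ff}\succ0$. *)

(* Defs.v *)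
From HB Require Import structures.
From mathcomp Require Import all_boot all_order all_algebra.
From mathcomp Require Import sesquilinear.
From mathcomp Require Import all_classical all_reals all_analysis.

Set Implicit Arguments.
Unset Strict Implicit.
Unset Printing Implicit Defensive.

Import Order.TTheory GRing.Theory Num.Theory.
Import numFieldNormedType.Exports.

Local Open Scope classical_set_scope.
Local Open Scope ring_scope.

Section Euclidean.
Variables (R : realType) (m : nat).
Implicit Types (u v y : 'cV[R]_m) (U : {vspace 'cV[R]_m}) (E : set 'cV[R]_m).

Definition edot u v : R := \sum_i u i 0 * v i 0.

Fact edot_is_bilinear : bilinear_for
  (GRing.Scale.Law.clone _ _ *%R _) (GRing.Scale.Law.clone _ _ (idfun \; *%R) _)
  edot.
Proof.
split=> [w|w] a u v /=; rewrite /edot mulr_sumr -big_split /=;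
  apply: eq_bigr => i _; rewrite !mxE.
- by rewrite mulrDl mulrA.
- by rewrite mulrDr mulrCA.
Qed.

HB.instance Definition _ :=
  bilinear_isBilinear.Build R _ _ _ _ _ edot edot_is_bilinear.

Fact edot_is_symmetric u v : edot u v = (-1) ^+ false * idfun (edot v u).
Proof. by rewrite mul1r /=; apply: eq_bigr => i _; rewrite mulrC. Qed.

HB.instance Definition _ :=
  isHermitianSesquilinear.Build R _ false idfun edot edot_is_symmetric.

Fact edot_gt0 u : u != 0 -> 0 < edot u u.
Proof.
move=> u0; rewrite lt0r sumr_ge0 ?andbT => [|i _]; last by rewrite -expr2 sqr_ge0.
apply: contraNneq u0 => /eqP; rewrite psumr_eq0 => [|i _].
  move=> /allP u0; apply/eqP/colP => i; rewrite mxE; apply/eqP.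
  by have := u0 i (mem_index_enum _); rewrite mulf_eq0 orbb.
by rewrite -expr2 sqr_ge0.
Qed.

HB.instance Definition _ := isDotProduct.Build R _ edot edot_gt0.

(* The library norm `|v| on matrices is the sup norm. *)
Definition enorm v : R := Num.sqrt (edot v v).

Definition edistance y E : R := inf [set enorm (y - z) | z in E].

Definition eortho U : {vspace 'cV[R]_m} := orthov (@edot) U.

Lemma mem_eortho U v : reflect {in U, forall u, edot v u = 0} (v \in eortho U).
Proof. exact: mem_orthovP. Qed.

Definition eproj U : 'End('cV[R]_m) := daddv_pi U (eortho U).

Lemma eortho_disjoint U : (U :&: eortho U = 0)%VS.
Proof.
apply/eqP; rewrite -subv0; apply/subvP => v.
rewrite memv_cap memv0 => /andP[vU /mem_eortho/(_ v vU) v0].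
by apply: contraT => /edot_gt0; rewrite v0 ltxx.
Qed.

End Euclidean.

Definition symmetric_mx (R : realType) n (A : 'M[R]_n) : Prop := A^T = A.

Definition posdef_mx (R : realType) n (A : 'M[R]_n) : Prop :=
  forall u : 'cV[R]_n, u != 0 -> 0 < edot u (A *m u).

Section Tasks.
Variables (R : realType) (n J : nat) (f g : 'I_J -> 'cV[R]_n).
Implicit Types (X A : 'M[R]_n) (l : 'cV[R]_J).

Definition sym A : 'M[R]_n := 2^-1 *: (A + A^T).

Definition task_mx (j : 'I_J) : 'M[R]_n := g j *m (f j)^T.

Definition response X : 'cV[R]_J := \col_j ((g j)^T *m X *m f j) 0 0.

Definition task_space : {vspace 'M[R]_n} := <<[seq task_mx j | j : 'I_J]>>%VS.

Definition sym_task_space : {vspace 'M[R]_n} :=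
  <<[seq sym (task_mx j) | j : 'I_J]>>%VS.

Definition task_defect : int := (\dim task_space)%:Z - (\dim sym_task_space)%:Z.

Definition task_comb l : 'M[R]_n := \sum_j l j 0 *: task_mx j.

Fact task_comb_is_linear : linear task_comb.
Proof.
move=> a l l'; rewrite /task_comb scaler_sumr -big_split /=.
by apply: eq_bigr => j _; rewrite !mxE scalerDl scalerA.
Qed.

HB.instance Definition _ :=
  GRing.isLinear.Build R _ _ _ task_comb task_comb_is_linear.

Fact sym_is_linear : linear sym.
Proof.
move=> a A B; rewrite /sym linearP /= addrACA -(scalerDr a A).
by rewrite (scalerDr 2^-1 (a *: _)) !scalerA mulrC.
Qed.

HB.instance Definition _ := GRing.isLinear.Build R _ _ _ sym sym_is_linear.

Definition ann0 : {vspace 'cV[R]_J} := lker (linfun task_comb).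

Definition ann : {vspace 'cV[R]_J} := lker (linfun (sym \o task_comb)).

Lemma mem_ann0 l : (l \in ann0) = (task_comb l == 0).
Proof. by rewrite memv_ker lfunE. Qed.

Lemma mem_ann l : (l \in ann) = (sym (task_comb l) == 0).
Proof. by rewrite memv_ker lfunE. Qed.

Definition ann1 : {vspace 'cV[R]_J} := (ann :&: eortho ann0)%VS.

Definition sym_reachable : {vspace 'cV[R]_J} := eortho ann.

End Tasks.

Definition rot90 (R : realType) (v : 'cV[R]_2) : 'cV[R]_2 :=
  \col_(c < 2) if c == 0 then - v 1 0 else v 0 0.

(* The coordinate of node i along axis c is the degree of freedom
   mxvec_index i c : 'I_(N * 2). *)
Definition nodal (R : realType) N (u : 'I_N -> 'cV[R]_2) : 'cV[R]_(N * 2) :=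
  (mxvec (\matrix_(i < N, c < 2) u i c 0))^T.

(* Infinitesimal rigid motion: translation by c plus rotation at rate w. *)
Definition rigid_mode (R : realType) N (pos : 'I_N -> 'cV[R]_2)
    (c : 'cV[R]_2) (w : R) : 'cV[R]_(N * 2) :=
  nodal (fun i => c + w *: rot90 (pos i)).

Record network (R : realType) (N nb n : nat) := Network {
  pos : 'I_N -> 'cV[R]_2;
  bond : 'I_nb -> 'I_N * 'I_N;
  bond_length_gt0 : forall b, 0 < enorm (pos (bond b).2 - pos (bond b).1);
  pinned : {set 'I_(N * 2)};
  card_pinned : #|pinned| = 3%N;
  pinned_rigid : forall c w,
    (forall d, d \in pinned -> rigid_mode pos c w d 0 = 0) ->
    rigid_mode pos c w = 0;
  (* an enumeration, in any order, of the degrees of freedom left free *)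
  free_dof : 'I_n -> 'I_(N * 2);
  free_dof_inj : injective free_dof;
  free_dofP : forall d, (d \in codom free_dof) = (d \notin pinned)
}.

Section Networks.
Variables (R : realType) (N nb n : nat) (W : network R N nb n).

Lemma n_freeE : (n + 3 = N * 2)%N.
Proof.
have <- : #|codom (free_dof W)| = n.
  by rewrite card_codom ?card_ord //; apply: free_dof_inj.
rewrite -(card_pinned W) addnC -[RHS]card_ord -(cardC (mem (pinned W))).
by congr addn; apply: eq_card => d; rewrite free_dofP.
Qed.

Definition bond_vec (b : 'I_nb) : 'cV[R]_2 :=
  pos W (bond W b).2 - pos W (bond W b).1.

Definition bond_dir b : 'cV[R]_2 := (enorm (bond_vec b))^-1 *: bond_vec b.

(* - v at the first end of b, + v at the second, 0 at the other nodes *)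
Definition bond_load b (v : 'cV[R]_2) : 'cV[R]_(N * 2) :=
  nodal (fun i => ((i == (bond W b).2)%:R - (i == (bond W b).1)%:R) *: v).

Definition axial b := bond_load b (bond_dir b).

Definition transverse b := bond_load b (rot90 (bond_dir b)).

Definition stiffness (k a : 'I_nb -> R) : 'M[R]_(N * 2) :=
  \sum_b (k b *: axial b + a b *: transverse b) *m (axial b)^T.

Definition free_stiffness k a : 'M[R]_n :=
  mxsub (free_dof W) (free_dof W) (stiffness k a).

Definition admissible k a : Prop :=
  (forall b, 0 < k b) /\ free_stiffness k a \in unitmx.

Definition passive k a : Prop :=
  (forall b, a b = 0) /\ posdef_mx (free_stiffness k a).

Definition compliance k a : 'M[R]_n := invmx (free_stiffness k a).

End Networks.

(* Main.v *)
From HB Require Import structures.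
Require Import Defs.
From mathcomp Require Import all_boot all_order all_algebra.
From mathcomp Require Import sesquilinear.
From mathcomp Require Import all_classical all_reals all_analysis.

(** Pairing a response with l gives the trace form of X against M(l), so the
    responses of all matrices form the orthogonal of the kernel of M, and those
    of symmetric matrices the orthogonal of the kernel of sym M; the distances
    are then norms of orthogonal projections. Invertibility costs nothing in
    the infimum because C + e I is invertible for arbitrarily small e > 0; the
    same shift moves any target by e y(I), which lies in S, and shows that the
    targets without an invertible optimum have empty interior. A single bond
    with one free degree of freedom and target 0 gives strictness: its
    compliance never vanishes. *)

Set Implicit Arguments.
Unset Strict Implicit.
Unset Printing Implicit Defensive.

Import Order.TTheory GRing.Theory Num.Theory.
Import numFieldNormedType.Exports.
Local Open Scope classical_set_scope.
Local Open Scope ring_scope.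

(** * Attained infima and the dimension of column spaces *)

Lemma inf_min (R : realType) (E : set R) x : E x -> lbound E x -> inf E = x.
Proof.
move=> Ex lbx; apply/eqP; rewrite eq_le; apply/andP; split.
  by apply: ge_inf => //; exists x.
by apply: lb_le_inf => //; exists x.
Qed.

Lemma dim_cVf (F : fieldType) n : \dim {: 'cV[F]_n} = n.
Proof. by rewrite dimvf dim_matrix [RHS](esym (muln1 n)). Qed.

(** * Orthogonal complements and projections for the Euclidean dot product *)

Section EuclideanTheory.
Variables (R : realType) (m : nat).
Implicit Types (u v y : 'cV[R]_m) (U V : {vspace 'cV[R]_m}).

Lemma edotC u v : edot u v = edot v u.
Proof. by apply: eq_bigr => i _; rewrite mulrC. Qed.

Lemma edotDl u v y : edot (u + v) y = edot u y + edot v y.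
Proof. by rewrite linearDl. Qed.

Lemma edotBl u v y : edot (u - v) y = edot u y - edot v y.
Proof. by rewrite linearBl. Qed.

Lemma edotDr u v y : edot y (u + v) = edot y u + edot y v.
Proof. by rewrite linearDr. Qed.

Lemma edotZl a u v : edot (a *: u) v = a * edot u v.
Proof. by rewrite linearZl_LR. Qed.

Lemma edotZr a u v : edot u (a *: v) = a * edot u v.
Proof. by rewrite edotC edotZl edotC. Qed.

Lemma edot_ge0 u : 0 <= edot u u.
Proof. by apply: sumr_ge0 => i _; rewrite -expr2 sqr_ge0. Qed.

Lemma edot_eq0 u : (edot u u == 0) = (u == 0).
Proof.
apply/eqP/eqP => [u0|->]; last by rewrite linear0l.
by apply/eqP; apply: contraT => /edot_gt0; rewrite u0 ltxx.
Qed.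

Lemma enorm_ge0 u : 0 <= enorm u. Proof. exact: sqrtr_ge0. Qed.

Lemma sqr_enorm u : enorm u ^+ 2 = edot u u.
Proof. by rewrite sqr_sqrtr ?edot_ge0. Qed.

Lemma enorm_eq0 u : enorm u = 0 <-> u = 0.
Proof.
split=> [u0|->]; last by rewrite /enorm linear0l sqrtr0.
by apply/eqP; rewrite -edot_eq0 -sqr_enorm u0 expr0n.
Qed.

Lemma enormN u : enorm (- u) = enorm u.
Proof. by rewrite /enorm linearNl linearNr opprK. Qed.

Lemma enorm_distC u v : enorm (u - v) = enorm (v - u).
Proof. by rewrite -enormN opprB. Qed.

Lemma edotDD u v : edot u v = 0 -> edot (u + v) (u + v) = edot u u + edot v v.
Proof.
by move=> uv; rewrite edotDl !edotDr (edotC v u) uv addr0 add0r.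
Qed.

Lemma sqr_enormD u v :
  edot u v = 0 -> enorm (u + v) ^+ 2 = enorm u ^+ 2 + enorm v ^+ 2.
Proof. by move=> uv; rewrite !sqr_enorm edotDD. Qed.

(** Rank-nullity for the map sending v to its dot products with a basis of U: the kernel lies in
    [eortho U] and the image has dimension at most [\dim U]. *)
Lemma dim_eortho U : (m <= \dim U + \dim (eortho U))%N.
Proof.
pose phi v : 'cV[R]_(\dim U) := \col_i edot v (vbasis U)`_i.
have phi_lin : linear phi.
  by move=> a u v; apply/colP => i; rewrite !mxE linearPl.
pose phiL := GRing.isLinear.Build _ _ _ _ phi phi_lin.
pose phi' : {linear 'cV[R]_m -> 'cV[R]_(\dim U)} := HB.pack phi phiL.
have kerphi : (lker (linfun phi') <= eortho U)%VS.
  apply/subvP => v; rewrite memv_ker lfunE /= => /eqP phiv0.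
  apply/mem_eortho => u /coord_vbasis ->.
  rewrite linear_sumr big1 // => i _.
  rewrite linearZr /=.
  have /colP/(_ i) := phiv0; rewrite !mxE => ->; by rewrite mulr0.
have := limg_ker_dim (linfun phi') fullv; rewrite capfv dim_cVf.
move=> dimE; rewrite -[leqLHS]dimE addnC leq_add ?dimvS //.
by apply: leq_trans (dimvS (subvf _)) _; rewrite dim_cVf.
Qed.

Lemma addv_eortho U : (U + eortho U = fullv)%VS.
Proof.
apply/eqP; rewrite eqEdim subvf dimv_disjoint_sum; last exact: eortho_disjoint.
by rewrite dim_cVf dim_eortho.
Qed.

Lemma eproj_mem U y : eproj U y \in U. Proof. exact: memv_pi. Qed.

Lemma sub_eproj_mem U y : y - eproj U y \in eortho U.
Proof.
have yU : y \in (U + eortho U)%VS by rewrite addv_eortho memvf.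
rewrite -{1}(daddv_pi_add (eortho_disjoint U) yU) addrAC subrr add0r.
exact: memv_pi.
Qed.

Lemma edot_eproj U y u : u \in U -> edot (eproj U y) u = edot y u.
Proof.
move=> uU; have /eqP := mem_eortho _ _ (sub_eproj_mem U y) u uU.
by rewrite edotBl subr_eq0 eq_sym => /eqP.
Qed.

(** The difference of [eproj U y] and v lies in U and is orthogonal to U, hence to itself. *)
Lemma eproj_uniq U y v : v \in U -> y - v \in eortho U -> eproj U y = v.
Proof.
move=> vU yvU; have dU : eproj U y - v \in U by rewrite rpredB ?eproj_mem.
apply/eqP; rewrite -subr_eq0 -edot_eq0 edotBl edot_eproj //.
by have := mem_eortho _ _ yvU _ dU; rewrite edotBl => ->.
Qed.

Lemma eprojB U y v : v \in eortho U -> eproj U (y - v) = eproj U y.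
Proof.
move=> vU; apply: eproj_uniq; first exact: eproj_mem.
by rewrite addrAC rpredB ?sub_eproj_mem.
Qed.

Lemma eortho_eproj U y : (y \in eortho U) = (eproj U y == 0).
Proof.
apply/idP/eqP => [yU|y0]; last by rewrite -[y]subr0 -y0 sub_eproj_mem.
by apply: eproj_uniq; rewrite ?mem0v ?subr0.
Qed.

(** For the nontrivial inclusion, the residual [y - eproj U y] lies both in [eortho U] and in its
    orthogonal, so it vanishes. *)
Lemma eorthoK U : eortho (eortho U) = U.
Proof.
apply/eqP; rewrite eqEsubv; apply/andP; split; apply/subvP => y yU.
  have yE : y - eproj U y \in eortho (eortho U).
    rewrite rpredB //; apply/mem_eortho => u /mem_eortho uU.
    by rewrite edotC uU ?eproj_mem.
  have : y - eproj U y == 0.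
    by rewrite -edot_eq0 (mem_eortho _ _ yE) ?sub_eproj_mem.
  by rewrite subr_eq0 => /eqP ->; apply: eproj_mem.
by apply/mem_eortho => u /mem_eortho uU; rewrite edotC uU.
Qed.

(** Subtracting z does not change the projection onto U, and by Pythagoras a projection is no longer
    than the vector projected. *)
Lemma enorm_eproj_le U y z : z \in eortho U -> enorm (eproj U y) <= enorm (y - z).
Proof.
move=> zU; rewrite -(@ler_pXn2r _ 2) ?nnegrE ?enorm_ge0 //.
rewrite -(eprojB y zU); set w := y - z; rewrite -[in leRHS](subrK (eproj U w) w).
rewrite sqr_enormD ?lerDr ?sqr_ge0 //.
by rewrite (mem_eortho _ _ (sub_eproj_mem U _)) ?eproj_mem.
Qed.

Lemma edistance_eortho U y :
  edistance y [set` eortho U] = enorm (eproj U y).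
Proof.
apply: inf_min => [|_ [z zU <-]]; last exact: enorm_eproj_le.
by exists (y - eproj U y); rewrite ?subKr //=; apply: sub_eproj_mem.
Qed.

Lemma eproj_split U V y : (U <= V)%VS ->
  eproj V y = eproj U y + eproj (V :&: eortho U)%VS y.
Proof.
move=> UV; apply: eproj_uniq.
  rewrite rpredD ?(subvP UV _ (eproj_mem U y)) //.
  by have := eproj_mem (V :&: eortho U) y; rewrite memv_cap => /andP[].
(* Split the test vector v into its part in U and its part in V orthogonal to U; each part sees only
   one of the two projections. *)
apply/mem_eortho => v vV; rewrite -[v](subrK (eproj U v)).
set w := v - _; have wVU : w \in (V :&: eortho U)%VS.
  by rewrite memv_cap rpredB ?(subvP UV _ (eproj_mem U v)) ?sub_eproj_mem.
have capE u : u \in (V :&: eortho U)%VS -> u \in eortho U.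
  by rewrite memv_cap => /andP[].
have wU := mem_eortho _ _ (capE _ wVU).
have pU := mem_eortho _ _ (capE _ (eproj_mem (V :&: eortho U) y)).
rewrite edotDr opprD addrA 2!(edotBl (y - _)) (edot_eproj y wVU) edotBl.
rewrite [edot (eproj U y) w]edotC wU ?eproj_mem // pU ?eproj_mem // !subr0.
by rewrite (mem_eortho _ _ (sub_eproj_mem U y)) ?eproj_mem // subrr addr0.
Qed.

(** V is the direct sum of U and the part of V orthogonal to U. *)
Lemma dim_cap_eortho U V : (U <= V)%VS ->
  \dim V = (\dim U + \dim (V :&: eortho U))%N.
Proof.
move=> UV; have dxUV : (U :&: (V :&: eortho U) = 0)%VS.
  by apply/eqP; rewrite -subv0 -(eortho_disjoint U) capvS ?capvSr.
rewrite -(dimv_disjoint_sum dxUV); congr (\dim _); apply/eqP.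
rewrite eqEsubv; apply/andP; split; last by rewrite subv_add UV capvSl.
apply/subvP => v vV; rewrite -[v](subrK (eproj U v)) addrC memv_add ?eproj_mem //.
by rewrite memv_cap rpredB ?(subvP UV _ (eproj_mem U v)) ?sub_eproj_mem.
Qed.

End EuclideanTheory.

(** * The trace form, self-adjointness of [sym], and images of adjoint maps *)

Section TraceForm.
Variables (R : realType) (n : nat).
Implicit Types A B C : 'M[R]_n.

(** The trace is the sum of the squares of all entries of A. *)
Lemma mxtrace_trmulmx_eq0 A : \tr (A^T *m A) = 0 -> A = 0.
Proof.
move=> trA0; apply/matrixP => i j; rewrite mxE.
have sq_ge0 (p q : 'I_n) : 0 <= A^T p q * A q p by rewrite mxE -expr2 sqr_ge0.
have Aj0 : \sum_k A^T j k * A k j = 0.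
  move/eqP: trA0; rewrite psumr_eq0 => [/allP/(_ j)|k _].
    by rewrite mem_index_enum mxE => /(_ isT)/eqP.
  by rewrite mxE sumr_ge0.
move/eqP: Aj0; rewrite psumr_eq0 // => /allP/(_ i); rewrite mem_index_enum mxE.
by rewrite mulf_eq0 orbb => /(_ isT)/eqP.
Qed.

Lemma mxtrace_sym A B : \tr (A^T *m sym B) = \tr ((sym A)^T *m B).
Proof.
rewrite /sym -scalemxAr [(_ *: _)^T]linearZ /= -scalemxAl !mxtraceZ; congr (_ * _).
rewrite [(_ + _)^T]linearD /= trmxK mulmxDr mulmxDl !raddfD /=; congr (_ + _).
by rewrite -mxtrace_tr trmx_mul !trmxK mxtrace_mulC.
Qed.

Lemma symmetric_sym A : symmetric_mx (sym A).
Proof. by rewrite /symmetric_mx /sym linearZ linearD /= trmxK addrC. Qed.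

Lemma sym_id A : symmetric_mx A -> sym A = A.
Proof.
by move=> AT; rewrite /sym AT -mulr2n -[A *+ 2]scaler_nat scalerA mulVf ?scale1r.
Qed.

(** The image of T is the orthogonal of the kernel of its adjoint L. After taking orthogonals, a
    vector l orthogonal to the image is tested against [T (L l)], which makes the trace form of
    [L l] with itself vanish. *)
Lemma limg_adjoint J (T : {linear 'M[R]_n -> 'cV[R]_J})
    (L : {linear 'cV[R]_J -> 'M[R]_n}) :
    (forall C l, edot (T C) l = \tr ((L l)^T *m C)) ->
  limg (linfun T) = eortho (lker (linfun L)).
Proof.
move=> TL; rewrite -[LHS]eorthoK; congr eortho; apply/vspaceP => l.
rewrite memv_ker lfunE /=; apply/mem_eortho/eqP => [lT|Ll0 _ /memv_imgP[C _ ->]].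
  apply: mxtrace_trmulmx_eq0; rewrite -TL edotC -(lfunE T) lT //.
  by rewrite memv_img ?memvf.
by rewrite lfunE edotC TL Ll0 trmx0 mul0mx mxtrace0.
Qed.

Lemma limg_span_delta J (vT : vectType R) (L : {linear 'cV[R]_J -> vT}) :
  limg (linfun L) = <<[seq L (delta_mx j 0%R) | j : 'I_J]>>%VS.
Proof.
apply/eqP; rewrite eqEsubv; apply/andP; split.
  apply/subvP => _ /memv_imgP[l _ ->]; rewrite lfunE /=.
  rewrite (matrix_sum_delta l) linear_sum rpred_sum // => j _.
  rewrite big_ord1 linearZ rpredZ // memv_span //.
  exact: (map_f (fun j => L (delta_mx j 0)) (mem_enum _ j)).
apply/span_subvP => _ /mapP[j _ ->].
by rewrite -(lfunE L) memv_img ?memvf.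
Qed.

End TraceForm.

(** * Reachable responses, annihilators and the defect *)

Section TaskTheory.
Variables (R : realType) (n J : nat) (f g : 'I_J -> 'cV[R]_n).
Implicit Types (C : 'M[R]_n) (l y : 'cV[R]_J).

Fact response_is_linear : linear (response f g).
Proof.
move=> a A B; apply/colP => j.
by rewrite [LHS]mxE mulmxDr mulmxDl -scalemxAr -scalemxAl !mxE.
Qed.

HB.instance Definition _ :=
  GRing.isLinear.Build R _ _ _ (response f g) response_is_linear.

(** Each response entry is the trace of the transposed task matrix times C, by cyclicity; so
    [response] is adjoint to [task_comb]. *)
Lemma edot_response C l :
  edot (response f g C) l = \tr ((task_comb f g l)^T *m C).
Proof.
rewrite /task_comb raddf_sum mulmx_suml raddf_sum; apply: eq_bigr => j _ /=.
rewrite linearZ /= -scalemxAl mxtraceZ mulrC; congr (_ * _).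
by rewrite mxE /task_mx trmx_mul trmxK -[X in \tr X]mulmxA mxtrace_mulC /mxtrace big_ord1.
Qed.

Lemma limg_response : limg (linfun (response f g)) = eortho (ann0 f g).
Proof. by apply: limg_adjoint => C l; apply: edot_response. Qed.

(** Composing with [sym] makes the responses of symmetric matrices the image of a linear map on all
    matrices; as [sym] is self-adjoint, the adjoint of this map is [sym \o task_comb]. *)
Lemma limg_response_sym :
  limg (linfun (response f g \o @sym R n)) = sym_reachable f g.
Proof.
by apply: limg_adjoint => C l /=; rewrite edot_response mxtrace_sym.
Qed.

Lemma range_response : range (response f g) = [set` eortho (ann0 f g)].
Proof.
apply/seteqP; split=> [_ [C _ <-]|y] /=; rewrite -limg_response.
  by rewrite -[response f g C](lfunE (response f g)) memv_img ?memvf.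
by case/memv_imgP => C _ ->; exists C; rewrite ?lfunE.
Qed.

Lemma response_symmetric_mem C :
  symmetric_mx C -> response f g C \in sym_reachable f g.
Proof.
move=> /sym_id <-; rewrite -limg_response_sym.
rewrite -[response f g _](lfunE (response f g \o @sym R n)).
by rewrite memv_img ?memvf.
Qed.

Lemma range_response_sym :
  [set response f g C | C in @symmetric_mx R n] = [set` sym_reachable f g].
Proof.
apply/seteqP; split=> [_ [C /response_symmetric_mem + <-] //|y] /=.
rewrite -limg_response_sym => /memv_imgP[C _ ->].
by exists (sym C); rewrite ?lfunE //; apply: symmetric_sym.
Qed.

Lemma ann0_sub : (ann0 f g <= ann f g)%VS.
Proof.
by apply/subvP => l; rewrite mem_ann0 mem_ann => /eqP ->; rewrite linear0.
Qed.

Lemma task_comb_delta j : task_comb f g (delta_mx j 0) = task_mx f g j.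
Proof.
rewrite /task_comb (bigD1 j) //= mxE !eqxx scale1r big1 ?addr0 // => i ij.
by rewrite mxE (negPf ij) scale0r.
Qed.

Lemma dim_ann0 : (\dim (ann0 f g) + \dim (task_space f g))%N = J.
Proof.
rewrite -[RHS](dim_cVf R) -(limg_ker_dim (linfun (task_comb f g)) fullv) capfv.
rewrite limg_span_delta /task_space; congr (_ + \dim <<_>>)%N.
by apply: eq_map => j /=; rewrite task_comb_delta.
Qed.

Lemma dim_ann : (\dim (ann f g) + \dim (sym_task_space f g))%N = J.
Proof.
rewrite -[RHS](dim_cVf R) -(limg_ker_dim (linfun (@sym R n \o task_comb f g)) fullv).
rewrite capfv limg_span_delta /sym_task_space; congr (_ + \dim <<_>>)%N.
by apply: eq_map => j /=; rewrite task_comb_delta.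
Qed.

(** By rank-nullity, [ann0] and [task_space], like [ann] and [sym_task_space], have dimensions
    adding up to J; so the defect is the codimension of [ann0] in [ann]. *)
Lemma dim_ann1 : (\dim (ann1 f g))%:Z = task_defect f g.
Proof.
rewrite /task_defect; apply/eqP; rewrite eq_sym subr_eq -PoszD; apply/eqP.
congr Posz; apply/eqP; rewrite -(eqn_add2l (\dim (ann0 f g))) dim_ann0 addnA.
by rewrite -dim_cap_eortho ?ann0_sub // dim_ann.
Qed.

Lemma enorm_eproj_ann_eq0 y : enorm (eproj (ann f g) y) = 0 <->
  (forall l, sym (task_comb f g l) = 0 -> \sum_j l j 0 * y j 0 = 0).
Proof.
rewrite enorm_eq0; split=> [/eqP + l l0|yl].
  rewrite -eortho_eproj => /mem_eortho/(_ l); rewrite mem_ann l0 eqxx.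
  by rewrite edotC; apply.
apply/eqP; rewrite -eortho_eproj; apply/mem_eortho => l.
by rewrite mem_ann edotC => /eqP/yl.
Qed.

(** The residual of the projection onto [ann] lies in [sym_reachable], every point of which is a
    symmetric response. *)
Lemma symmetric_optimum y : exists2 C, symmetric_mx C &
  response f g C = y - eproj (ann f g) y.
Proof.
have : [set` sym_reachable f g] (y - eproj (ann f g) y) by apply: sub_eproj_mem.
by rewrite -range_response_sym => -[C symC <-]; exists C.
Qed.

End TaskTheory.

(** * Small invertible shifts and continuity of determinants *)

Section InvertiblePerturbation.
Variables (R : realType).

Lemma poly_non_root_itv (p : {poly R}) d : p != 0 -> 0 < d ->
  exists2 e, 0 < e < d & ~~ root p e.
Proof.
(* These are [size p] distinct points, one more than the degree of p, so not all of them are roots.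
   Starting at [i.+2] keeps them strictly below d. *)
move=> p0 d0; pose s := [seq d / i.+2%:R | i <- iota 0 (size p)].
suff /allPn[_ /mapP[i _ ->] pi] : ~~ all (root p) s.
  exists (d / i.+2%:R) => //; rewrite divr_gt0 // ltr_pdivrMr // ltr_pMr //.
  by rewrite ltr1n.
apply/negP => s_root; have := max_poly_roots p0 s_root.
rewrite size_map size_iota ltnn map_inj_uniq ?iota_uniq => [/(_ isT)//|i j].
by move=> /(mulfI (lt0r_neq0 d0))/invr_inj/eqP; rewrite eqr_nat => /eqP[].
Qed.

(** The shifted matrix is singular exactly when e is an eigenvalue of [- A], so e need only avoid
    the roots of a nonzero polynomial. *)
Lemma shift_unitmx n (A : 'M[R]_n) (t r : R) : 0 <= t -> 0 < r ->
  exists e, [/\ 0 < e, e * t < r & A + e%:M \in unitmx].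
Proof.
move=> t0 r0; have t1 : 0 < t + 1 by rewrite ltr_wpDl.
have p0 : char_poly (- A) != 0 by rewrite monic_neq0 ?char_poly_monic.
(* Dividing by [t + 1] rather than t covers the case t = 0. *)
have [e /andP[e0 er] eA] := poly_non_root_itv p0 (divr_gt0 r0 t1).
exists e; split=> //.
  by move: er; rewrite ltr_pdivlMr // mulrDr mulr1; apply: lt_trans; rewrite ltrDl.
move: eA; rewrite -eigenvalue_root_char negbK kermx_eq0 row_free_unit.
by rewrite -opprD -scaleN1r unitmxZ // unitrN1.
Qed.

Lemma continuous_det n (T : topologicalType) (F : T -> 'M[R]_n) :
  (forall i j, continuous (fun t => F t i j)) ->
  continuous (fun t => \det (F t)).
Proof.
move=> Fc t; rewrite /determinant.
apply: cvg_big => [|s _]; first exact: add_continuous.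
apply: cvgM; first exact: cvg_cst.
apply: cvg_big => [|i _]; first exact: mul_continuous.
exact: Fc.
Qed.

Lemma continuous_affine_comb (T : topologicalType) J (a : 'I_J -> T -> R) b c :
  (forall k, continuous (a k)) -> continuous (fun t => c + \sum_k a k t * b k).
Proof.
move=> ac t; apply: cvgD; first exact: cvg_cst.
apply: cvg_big => [|k _]; first exact: add_continuous.
by apply: cvgM; [exact: ac|exact: cvg_cst].
Qed.

Lemma affine_coord_continuous n J (A : 'M[R]_n)
    (L : {linear 'cV[R]_J -> 'M[R]_n}) i j :
  continuous (fun z : 'cV[R]_J => (A + L z) i j).
Proof.
have -> : (fun z => (A + L z) i j) =
    fun z => A i j + \sum_k z k 0 * L (delta_mx k 0) i j.
  apply/funext => z; rewrite {1}(matrix_sum_delta z) linear_sum mxE summxE.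
  by congr (_ + _); apply: eq_bigr => k _; rewrite big_ord1 linearZ !mxE.
apply: (continuous_affine_comb (a := fun k (z : 'cV[R]_J) => z k 0)) => k.
exact: coord_continuous.
Qed.

End InvertiblePerturbation.

(** * The floor over symmetric invertible matrices *)

Section SymmetricInvertible.
Variables (R : realType) (n J : nat) (f g : 'I_J -> 'cV[R]_n).
Implicit Types (C : 'M[R]_n) (y : 'cV[R]_J).

Lemma symmetric_shift C e : symmetric_mx C -> symmetric_mx (C + e%:M).
Proof. by move=> symC; rewrite /symmetric_mx linearD /= symC tr_scalar_mx. Qed.

Lemma response_shift C e :
  response f g (C + e%:M) = response f g C + e *: response f g 1%:M.
Proof. by rewrite -[e%:M]scalemx1 linearD linearZ. Qed.

Lemma response1_mem : response f g 1%:M \in sym_reachable f g.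
Proof. by apply: response_symmetric_mem; rewrite /symmetric_mx tr_scalar_mx. Qed.

Lemma symmetric_floor y C : symmetric_mx C ->
  enorm (eproj (ann f g) y) <= enorm (response f g C - y).
Proof.
by move=> symC; rewrite enorm_distC enorm_eproj_le ?response_symmetric_mem.
Qed.

Lemma inf_symmetric_unitmx y :
  inf [set enorm (response f g C - y) | C in
         [set C : 'M[R]_n | symmetric_mx C /\ C \in unitmx]]
    = enorm (eproj (ann f g) y).
Proof.
set E := [set _ | _ in _]; set v := enorm _.
have lbE : lbound E v by move=> _ [C [symC _] <-]; apply: symmetric_floor.
have [C symC Cy] := symmetric_optimum f g y.
have t0 := enorm_ge0 (response f g 1%:M); set t := enorm _ in t0.
have approx r : 0 < r -> exists2 x, E x & x <= v + r.
  move=> r0; have [e [e0 er Ce]] := shift_unitmx C t0 r0.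
  exists (enorm (response f g (C + e%:M) - y)).
    by exists (C + e%:M) => //; split=> //; apply: symmetric_shift.
  rewrite response_shift Cy addrAC (addrAC y) subrr sub0r.
  rewrite -(@ler_pXn2r _ 2) ?nnegrE ?enorm_ge0 ?addr_ge0 ?enorm_ge0 ?(ltW r0) //.
  (* The residual lies in [ann] and the response of the identity in its orthogonal, so the shift
     adds to the error by Pythagoras. *)
  have perp : edot (- eproj (ann f g) y) (e *: response f g 1%:M) = 0.
    rewrite edotZr edotC (mem_eortho _ _ response1_mem) ?mulr0 //.
    by rewrite rpredN eproj_mem.
  rewrite sqr_enormD // enormN -/v.
  have -> : enorm (e *: response f g 1%:M) ^+ 2 = (e * t) ^+ 2.
    by rewrite sqr_enorm edotZl edotZr -sqr_enorm exprMn expr2 mulrA.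
  have et0 : 0 <= e * t by rewrite mulr_ge0 // ltW.
  have v0 : 0 <= v by apply: enorm_ge0.
  apply: (@le_trans _ _ ((v + e * t) ^+ 2)).
    by rewrite sqrrD addrAC lerDl mulrn_wge0 // mulr_ge0.
  by rewrite ler_pXn2r ?nnegrE ?addr_ge0 ?(ltW r0) // lerD2l ltW.
apply/eqP; rewrite eq_le; apply/andP; split.
  apply/ler_addgt0Pr => r /approx[x Ex xr]; apply: le_trans xr.
  by apply: ge_inf => //; exists v.
by apply: lb_le_inf => //; have [x Ex _] := approx 1 ltr01; exists x.
Qed.

(** Choosing optima linearly in the target lets one invertible optimum be carried continuously to
    nearby targets. *)
Lemma symmetric_section : exists phi : {linear 'cV[R]_J -> 'M[R]_n},
  forall y, symmetric_mx (phi y) /\ response f g (phi y) = y - eproj (ann f g) y.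
Proof.
pose T := linfun (response f g \o @sym R n).
pose phi y := sym (T^-1%VF (y - eproj (ann f g) y)).
have phi_lin : linear phi.
  by move=> a u v; rewrite /phi linearP opprD addrACA -scalerBr !linearP.
pose phiL := GRing.isLinear.Build _ _ _ _ phi phi_lin.
exists (HB.pack_for {linear 'cV[R]_J -> 'M[R]_n} phi phiL) => y /=; split; first exact: symmetric_sym.
have := @limg_lfunVK _ _ _ T (y - eproj (ann f g) y).
by rewrite limg_response_sym [T _]lfunE; apply; apply: sub_eproj_mem.
Qed.

Let bad : set 'cV[R]_J := [set y | ~ exists C,
  [/\ symmetric_mx C, C \in unitmx & response f g C = y - eproj (ann f g) y]].

(** If C is an invertible optimum at y, then [C - phi y + phi z] is a symmetric optimum at z that
    equals C at z = y; its determinant is continuous in z, hence nonzero near y. *)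
Lemma closed_no_invertible_optimum : closed bad.
Proof.
rewrite -[bad]setCK; apply: open_closedC; rewrite openE => y /contrapT[C [symC uC Cy]].
have [phi phiP] := symmetric_section.
pose F (z : 'cV[R]_J) := C - phi y + phi z.
have FE z : response f g (F z) = z - eproj (ann f g) z.
  by rewrite /F linearD linearB /= Cy !(phiP _).2 subrr add0r.
have symF z : symmetric_mx (F z).
  by rewrite /symmetric_mx /F linearD linearB /= symC !(phiP _).1.
have detF : continuous (fun z => \det (F z)).
  by apply: continuous_det => i j; apply: affine_coord_continuous.
have : \det (F y) != 0 by rewrite /F subrK -unitfE -unitmxE.
move=> /(cvgr_neq0 _ (detF y)); apply: filterS => z Fz /=; apply; exists (F z).
by split; rewrite ?unitmxE ?unitfE.
Qed.

(** Given any optimum C at y, moving the target by e times the response of the identity leaves its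
    projection onto [ann] unchanged, and the invertible matrix C + e I is optimal there. *)
Lemma interior_no_invertible_optimum : interior bad = set0.
Proof.
apply/seteqP; split=> // y /nbhs_normP[r /= r0 ball_bad].
have [C symC Cy] := symmetric_optimum f g y.
have [e [e0 er Ce]] := shift_unitmx C (normr_ge0 (response f g 1%:M)) r0.
apply: (ball_bad (y + e *: response f g 1%:M)).
  by rewrite /ball_ /= opprD addrA subrr sub0r normrN normrZ gtr0_norm.
exists (C + e%:M); split=> //; first exact: symmetric_shift.
(* The double negations turn the sum into the difference expected by [eprojB]. *)
rewrite response_shift Cy -[y in eproj _ (y + _)]opprK.
rewrite -(opprK (e *: response f g 1%:M)) eprojB ?opprK 1?addrAC //.
by rewrite rpredN rpredZ ?response1_mem.
Qed.

Lemma invertible_optimum_generic : exists B : set 'cV[R]_J,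
  [/\ closed B, interior B = set0 &
      forall y, ~ B y -> exists C,
        [/\ symmetric_mx C, C \in unitmx &
            enorm (response f g C - y) = enorm (eproj (ann f g) y)]].
Proof.
exists bad; split.
- exact: closed_no_invertible_optimum.
- exact: interior_no_invertible_optimum.
move=> y /contrapT[C [symC uC Cy]]; exists C; split=> //.
by rewrite Cy addrAC subrr sub0r enormN.
Qed.

End SymmetricInvertible.

(** * A single-bond network with one free degree of freedom *)

Section OneBond.
Variable R : realType.

(** The bond runs along the first axis from the origin, and only the axial displacement of its far
    end is free, so the free stiffness is a 1 by 1 matrix. *)
Let px (i : 'I_2) : 'cV[R]_2 := i%:R *: delta_mx 0 0.
Let free_x : 'I_(2 * 2) := mxvec_index ord_max 0.

Lemma nodalE N (u : 'I_N -> 'cV[R]_2) i c : nodal u (mxvec_index i c) 0 = u i c 0.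
Proof. by rewrite mxE mxvecE mxE. Qed.

Fact one_bond_length_gt0 (b : 'I_1) : 0 < enorm (px ord_max - px ord0).
Proof.
rewrite lt0r enorm_ge0 andbT; apply/eqP => /enorm_eq0/colP/(_ 0).
by rewrite !mxE /= mul1r mul0r subr0 => /eqP; rewrite oner_eq0.
Qed.

Fact one_bond_card_pinned : #|~: [set free_x]| = 3%N.
Proof. by have := cardsC [set free_x]; rewrite cards1 card_ord => -[]. Qed.

Fact one_bond_pinned_rigid c w :
  (forall d, d \in ~: [set free_x] -> rigid_mode px c w d 0 = 0) ->
  rigid_mode px c w = 0.
Proof.
move=> rigid0.
have pinned_dof i (a : 'I_2) : (i, a) != (ord_max, 0) -> (c + w *: rot90 (px i)) a 0 = 0.
  move=> ia; rewrite -(nodalE (fun i => c + w *: rot90 (px i))) rigid0 //.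
  rewrite !inE; apply: contraNneq ia => idx.
  have [h hK _] := curry_mxvec_bij 2 2.
  by apply/eqP/(can_inj (f := uncurry (@mxvec_index 2 2)) (g := h)) => // x; rewrite hK.
(* Pinning the node at the origin kills the translation c; pinning the transverse coordinate of the
   other node then kills the rotation rate w. *)
have := pinned_dof 0 0 isT; have := pinned_dof 0 1 isT.
have := pinned_dof 1 1 isT.
rewrite !mxE /= !mul0r mul1r oppr0 !mulr0 mulr1 !addr0 => + c1 c0.
rewrite c1 add0r => w0.
have -> : c = 0.
  apply/colP => -[[|[|//]] a2]; rewrite [RHS]mxE; [rewrite -[RHS]c0|rewrite -[RHS]c1];
    by congr (c _ _); apply: val_inj.
rewrite w0 /rigid_mode /nodal; apply/colP => d; rewrite mxE.
by case/mxvec_indexP: d => i a; rewrite mxvecE !mxE !mul0r addr0.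
Qed.

Fact one_bond_free_inj : injective (fun _ : 'I_1 => free_x).
Proof. by move=> i j _; rewrite !ord1. Qed.

Fact one_bond_freeP d :
  (d \in codom (fun _ : 'I_1 => free_x)) = (d \notin ~: [set free_x]).
Proof.
rewrite !inE negbK; apply/codomP/eqP => [[_ ->]//|->]; by exists 0.
Qed.

Definition one_bond : network R 2 1 1 :=
  @Network R 2 1 1 px (fun=> (ord0, ord_max)) one_bond_length_gt0
    (~: [set free_x]) one_bond_card_pinned one_bond_pinned_rigid
    (fun=> free_x) one_bond_free_inj one_bond_freeP.

(** Keeps the strictness claim from being vacuous. The single stiffness entry is the square of a
    nonzero axial component. *)
Lemma one_bond_admissible : admissible one_bond (fun=> 1) (fun=> 0).
Proof.
split=> [b|]; first exact: ltr01.
rewrite unitmxE unitfE det_mx11 mxE /stiffness big_ord1 scale0r addr0 scale1r.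
rewrite mxE big_ord1 [X in _ * X]mxE mulf_neq0 //;
  rewrite /axial /bond_load nodalE !mxE /= mul0r !subr0 !mul1r mulr1;
  by rewrite invr_eq0 gt_eqF //; apply: (one_bond_length_gt0 0).
Qed.

End OneBond.

(** * Symmetry and invertibility of passive stiffness matrices *)

Section NetworkTheory.
Variables (R : realType) (N nb n : nat) (W : network R N nb n).
Implicit Types k a : 'I_nb -> R.

Lemma posdef_unitmx (A : 'M[R]_n) : posdef_mx A -> A \in unitmx.
Proof.
(* [det0P] gives a row vector, so it is applied to the transpose to obtain a column in the kernel of
   A. *)
move=> posA; rewrite -unitmx_tr unitmxE unitfE; apply/det0P => -[v v0 vA].
have := posA v^T; rewrite -trmx_eq0 trmxK v0 => /(_ isT).
by rewrite -[A]trmxK -trmx_mul vA trmx0 linear0r ltxx.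
Qed.

(** Without odd couplings each bond contributes a multiple of the symmetric rank-one matrix of its
    axial vector. *)
Lemma free_stiffness_symmetric k a :
  (forall b, a b = 0) -> symmetric_mx (free_stiffness W k a).
Proof.
move=> a0; rewrite /symmetric_mx trmx_mxsub; congr mxsub.
rewrite /stiffness linear_sum; apply: eq_bigr => b _ /=.
by rewrite a0 scale0r addr0 trmx_mul trmxK linearZ /= -scalemxAl -scalemxAr.
Qed.

Lemma passive_symmetric_unitmx k a : passive W k a ->
  symmetric_mx (free_stiffness W k a) /\ free_stiffness W k a \in unitmx.
Proof.
by case=> a0 posK; split; [apply: free_stiffness_symmetric|apply: posdef_unitmx].
Qed.

Lemma compliance_symmetric k a :
  symmetric_mx (free_stiffness W k a) -> symmetric_mx (compliance W k a).
Proof. by move=> symK; rewrite /symmetric_mx trmx_inv symK. Qed.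

End NetworkTheory.

(** In dimension one with unit vectors the response is the sole entry of the compliance, which is
    also its nonzero determinant. *)
Lemma one_bond_response_neq0 (R : realType) k :
  admissible (one_bond R) k (fun=> 0) ->
  response (fun _ : 'I_1 => const_mx 1) (fun=> const_mx 1)
    (compliance (one_bond R) k (fun=> 0)) != 0.
Proof.
case=> _; rewrite -unitmx_inv unitmxE unitfE det_mx11; apply: contraNneq.
by move=> /colP/(_ 0); rewrite !(mxE, big_ord1) mul1r mulr1 => ->.
Qed.

Theorem theorem6 (R : realType) :
  (forall (n J : nat) (f g : 'I_J -> 'cV[R]_n),
    [/\
     (* the floor, for every network with n free degrees of freedom *)
     forall (ystar : 'cV[R]_J) (N nb : nat) (W : network R N nb n)
         (k a : 'I_nb -> R),
       (passive W k a ->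
          symmetric_mx (free_stiffness W k a) /\
          free_stiffness W k a \in unitmx) /\
       (admissible W k a -> symmetric_mx (free_stiffness W k a) ->
          edistance ystar [set` sym_reachable f g]
            <= enorm (response f g (compliance W k a) - ystar)),
     forall ystar : 'cV[R]_J,
       edistance ystar [set` sym_reachable f g]
         = enorm (eproj (ann f g) ystar),
     (* the orthogonal splitting and its interpretation *)
     (forall ystar : 'cV[R]_J,
       [/\ eproj (ann f g) ystar
             = eproj (ann0 f g) ystar + eproj (ann1 f g) ystar,
           edot (eproj (ann0 f g) ystar) (eproj (ann1 f g) ystar) = 0,
           enorm (eproj (ann f g) ystar) ^+ 2
             = enorm (eproj (ann0 f g) ystar) ^+ 2
               + enorm (eproj (ann1 f g) ystar) ^+ 2,
           enorm (eproj (ann0 f g) ystar)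
             = edistance ystar (range (response f g))
         & edistance ystar [set response f g C | C in @symmetric_mx R n] ^+ 2
             = edistance ystar (range (response f g)) ^+ 2
               + enorm (eproj (ann1 f g) ystar) ^+ 2])
     /\ (\dim (ann1 f g))%:Z = task_defect f g,
     (* vanishing of the floor *)
     forall ystar : 'cV[R]_J,
       enorm (eproj (ann f g) ystar) = 0 <->
       (forall l : 'cV[R]_J, sym (task_comb f g l) = 0 ->
          \sum_j l j 0 * ystar j 0 = 0)
     (* sharpness over symmetric, and over symmetric invertible, matrices *)
   & [/\ forall (ystar : 'cV[R]_J) (C : 'M[R]_n), symmetric_mx C ->
           enorm (eproj (ann f g) ystar) <= enorm (response f g C - ystar),
         forall ystar : 'cV[R]_J, exists2 C : 'M[R]_n, symmetric_mx C &
           enorm (response f g C - ystar) = enorm (eproj (ann f g) ystar),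
         forall ystar : 'cV[R]_J,
           inf [set enorm (response f g C - ystar) | C in
                  [set C : 'M[R]_n | symmetric_mx C /\ C \in unitmx]]
             = enorm (eproj (ann f g) ystar)
       & exists B : set 'cV[R]_J,
           [/\ closed B, interior B = set0 &
               forall ystar : 'cV[R]_J, ~ B ystar ->
                 exists C : 'M[R]_n,
                   [/\ symmetric_mx C, C \in unitmx &
                       enorm (response f g C - ystar)
                         = enorm (eproj (ann f g) ystar)]]]])
  /\
  (* strictness on some fixed passive graph *)
  (exists (N nb n J : nat) (W : network R N nb n) (f g : 'I_J -> 'cV[R]_n)
          (ystar : 'cV[R]_J),
     (exists k : 'I_nb -> R, admissible W k (fun=> 0)) /\
     (forall k : 'I_nb -> R, admissible W k (fun=> 0) ->
        enorm (eproj (ann f g) ystar)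
          < enorm (response f g (compliance W k (fun=> 0)) - ystar))).
Proof.
split=> [n J f g|].
  split.
  - move=> y N nb W k a; split; first exact: passive_symmetric_unitmx.
    move=> _ /compliance_symmetric symC.
    by rewrite edistance_eortho; apply: symmetric_floor.
  - by move=> y; apply: edistance_eortho.
  - split; last exact: dim_ann1.
    move=> y; have splitE := eproj_split y (ann0_sub f g).
    have perp : edot (eproj (ann0 f g) y) (eproj (ann1 f g) y) = 0.
      have := eproj_mem (ann1 f g) y; rewrite memv_cap edotC => /andP[_].
      by move=> /mem_eortho; apply; apply: eproj_mem.
    have sqrE := sqr_enormD perp; rewrite -splitE in sqrE.
    by split; rewrite // ?range_response_sym range_response !edistance_eortho.
  - by move=> y; apply: enorm_eproj_ann_eq0.
  - split.
    + exact: symmetric_floor.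
    + move=> y; have [C symC Cy] := symmetric_optimum f g y; exists C => //.
      by rewrite Cy addrAC subrr sub0r enormN.
    + exact: inf_symmetric_unitmx.
    + exact: invertible_optimum_generic.
(* With target 0 the floor is 0, so strictness only asks that the response be nonzero. *)
exists 2, 1, 1, 1, (one_bond R), (fun=> const_mx 1), (fun=> const_mx 1), 0.
split; first by exists (fun=> 1); apply: one_bond_admissible.
move=> k /one_bond_response_neq0 C0; rewrite linear0 subr0 (proj2 (enorm_eq0 _)) //.
by rewrite lt0r enorm_ge0 andbT; apply: contraNneq C0 => /enorm_eq0/eqP.
Qed.
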